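(* Let $\lambda\in\mathbb{R}\setminus\{0\}$ and let $\psi\in\mathcal{D}_{W,V}(\mathbb{T})$ satisfy $-\Delta_{W,V}\psi=\lambda\psi$. Then $\psi$ belongs to $C^{\infty}_{W,V,0}(\mathbb{T})=\bigcap_{n\in\mathbb{N}}C^{n}_{W,V,0}(\mathbb{T})$ (that is, $\psi$ coincides $V$-a.e. with an element of this space).
   Context: Setting. $\mathbb{T}=\mathbb{R}/\mathbb{Z}$, identified with $[0,1)$ with tagged point $0$. A càdlàg function is right-continuous with left limits; a càglàd function is left-continuous with right limits. $W,V:\mathbb{R}\to\mathbb{R}$ are strictly increasing, $W$ càdlàg, $V$ càglàd, with $W(x+1)-W(x)=W(1)-W(0)$ and $V(x+1)-V(x)=V(1)-V(0)$ for all $x$; both are continuous at $0$ and $W(0)=V(0)=0$. They induce finite Borel measures on $\mathbb{T}$ with $dW((a,b])=W(b)-W(a)$, $dV([a,b))=V(b)-V(a)$ (atoms allowed). $L^2_V(\mathbb{T})=L^2(\mathbb{T},dV)$, and $L^2_{V,0}(\mathbb{T})$ is its subspace of functions with $\int_{\mathbb{T}}f\,dV=0$. One-sided derivatives: $D_W^-f(x)=\lim_{h\to0^-}\frac{f(x+h)-f(x)}{W(x+h)-W(x)}$ and $D_V^+g(x)=\lim_{h\to0^+}\frac{g(x+h)-g(x)}{V(x+h)-V(x)}$, required to exist at every $x\in\mathbb{T}$. The $W$-$V$-Laplacian (it equals $I-\mathcal{A}$, where $\mathcal{A}$ is the Friedrichs extension in $L^2_V(\mathbb{T})$ of $I-D_V^+D_W^-$):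 its domain $\mathcal{D}_{W,V}(\mathbb{T})$ is the set of $f\in L^2_V(\mathbb{T})$ for which there are $a,b\in\mathbb{R}$ and $\mathfrak{f}\in L^2_{V,0}(\mathbb{T})$ with $f(x)=a+bW(x)+\int_{(0,x]}\int_{[0,y)}\mathfrak{f}(s)\,dV(s)\,dW(y)$ $V$-a.e. and $bW(1)+\int_{(0,1]}\int_{[0,y)}\mathfrak{f}(s)\,dV(s)\,dW(y)=0$; then $\Delta_{W,V}f=\mathfrak{f}$. Smooth functions: $C_0(\mathbb{T})$ is the set of càdlàg $f:\mathbb{T}\to\mathbb{R}$ with $\int_{\mathbb{T}}f\,dV=0$; $C_1(\mathbb{T})$ is the set of càglàd $f:\mathbb{T}\to\mathbb{R}$ with $\int_{\mathbb{T}}f\,dW=0$. $D^{(1)}_{W,V}=D_W^-$, $D^{(2)}_{W,V}=D_V^+D_W^-$, $D^{(3)}_{W,V}=D_W^-D_V^+D_W^-$, and so on alternately ($n$ factors, $D_W^-$ applied first). $\sigma(n)=1$ for $n$ odd, $\sigma(n)=0$ for $n$ even. $C^n_{W,V,0}(\mathbb{T})$ is the set of $f\in C_0(\mathbb{T})$ such that $D^{(k)}_{W,V}f$ exists and belongs to $C_{\sigma(k)}(\mathbb{T})$ for all $1\le k\le n$. *)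

(* Defs.v *)
From HB Require Import structures.
From mathcomp Require Import all_boot all_order all_algebra.
From mathcomp Require Import all_classical all_reals all_analysis.
Set Implicit Arguments.
Unset Strict Implicit.
Unset Printing Implicit Defensive.
Import Order.TTheory GRing.Theory Num.Theory.
Import numFieldTopology.Exports numFieldNormedType.Exports.
Local Open Scope classical_set_scope.
Local Open Scope ring_scope.

(* Functions on the torus R/Z are represented by 1-periodic functions on R, with
   fundamental domain [0, 1[. *)
Section WVLaplacian.
Context {R : realType}.
Implicit Types (f g W V : R -> R) (k n : nat).
Implicit Types (dW dV mu : {measure set (measurableTypeR R) -> \bar R}).

Definition cadlag f := forall x, f @ x^'+ --> f x /\ cvg (f @ x^'-).

Definition caglad f := forall x, f @ x^'- --> f x /\ cvg (f @ x^'+).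

(* The measure induced on the torus by a measure on R: its restriction to
   [0, 1[, as a measure on R. *)
Definition torus mu :=
  mrestr mu (measurable_itv `[0 : R, 1[ :
    measurable (`[0, 1[%classic : set (measurableTypeR R))).

Definition zero_mean mu f := \int[torus mu]_x f x = 0.

Definition L2_torus mu f := periodic f 1 /\ f \in Lfun (torus mu) 2%:E.

Definition L2_torus0 mu f := L2_torus mu f /\ zero_mean mu f.

Definition WV_potential dW dV f (x : R) : R :=
  \int[dW]_(y in `]0, x]) \int[dV]_(s in `[0, y[) f s.

(* The graph of the W-V-Laplacian: f is in its domain and g represents its
   image in L2_torus0 dV. *)
Definition WV_laplacian W dW dV f g :=
  L2_torus dV f /\ L2_torus0 dV g /\
  exists a b : R,
    {ae torus dV, forall x, f x = a + b * W x + WV_potential dW dV g x} /\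
    b * W 1 + WV_potential dW dV g 1 = 0.

Definition quotient W f (x h : R) := (f (x + h) - f x) / (W (x + h) - W x).

Definition left_derivable W f := forall x, cvg (quotient W f x h @[h --> 0^'-]).
Definition left_derive W f (x : R) : R := lim (quotient W f x h @[h --> 0^'-]).

Definition right_derivable V f := forall x, cvg (quotient V f x h @[h --> 0^'+]).
Definition right_derive V f (x : R) : R := lim (quotient V f x h @[h --> 0^'+]).

(* Only meaningful when WV_derivable W V k f holds, as lim is total. *)
Fixpoint WV_derive W V k f : R -> R :=
  if k is k'.+1 then
    if odd k' then right_derive V (WV_derive W V k' f)
    else left_derive W (WV_derive W V k' f)
  else f.

Fixpoint WV_derivable W V k f : Prop :=
  if k is k'.+1 then
    WV_derivable W V k' f /\
    (if odd k' then right_derivable V (WV_derive W V k' f)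
     else left_derivable W (WV_derive W V k' f))
  else True.

Definition C0_torus dV f := [/\ periodic f 1, cadlag f & zero_mean dV f].

Definition C1_torus dW f := [/\ periodic f 1, caglad f & zero_mean dW f].

Definition Csigma_torus dW dV k f :=
  if odd k then C1_torus dW f else C0_torus dV f.

Definition Cn_WV0 W V dW dV n f :=
  C0_torus dV f /\
  forall k, (1 <= k <= n)%N ->
    WV_derivable W V k f /\ Csigma_torus dW dV k (WV_derive W V k f).

Definition Coo_WV0 W V dW dV f := forall n, Cn_WV0 W V dW dV n f.

End WVLaplacian.

(* Main.v *)
Require Import Defs.
From HB Require Import structures.
From mathcomp Require Import all_boot all_order all_algebra.
From mathcomp Require Import all_classical all_reals all_analysis.
From mathcomp Require Import measurable_realfun.
Set Implicit Arguments.
Unset Strict Implicit.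
Unset Printing Implicit Defensive.
Import Order.TTheory GRing.Theory Num.Theory.
Import numFieldTopology.Exports numFieldNormedType.Exports.
Local Open Scope classical_set_scope.
Local Open Scope ring_scope.

(* The integral formula for psi, whose density is -lambda psi, is a first order
   system phi' = G dW, G' = -lambda phi dV on [0, 1], and both compatibility
   conditions (zero mean of Dpsi, vanishing of the potential at 1) say that its
   solution takes equal values at 0 and 1, hence extends periodically.
   Regularity is then bootstrapped: G is bounded, so phi is dominated by W and
   right-continuous; phi is bounded, so G is dominated by V and left-continuous.
   Averaging one-sidedly continuous functions, D_W^- phi = G and
   D_V^+ G = -lambda phi everywhere, and all further derivatives are multiples
   of phi or G. *)

(** * Measurability and averaging of integrals *)

Lemma measurable_Rintegral_increasing d (T : measurableType d) (R : realType)
    (mu : {measure set T -> \bar R}) (D : set T) (A : R -> set T) (g : T -> R) :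
  measurable D -> (forall y, measurable (A y)) -> (forall y, A y `<=` D) ->
  {homo A : x y / x <= y >-> x `<=` y} -> mu.-integrable D (EFin \o g) ->
  measurable_fun setT (fun y => \int[mu]_(s in A y) g s).
Proof.
move=> mD mA AD Ahomo ig.
have iA y : mu.-integrable (A y) (EFin \o g) by exact: integrableS ig.
(* Positive and negative parts reduce the claim to [f >= 0], whose integral over growing sets is
   nondecreasing in [y], hence measurable. *)
suff key f : (forall x, 0 <= f x) -> mu.-integrable D (EFin \o f) ->
    measurable_fun setT (fun y => \int[mu]_(s in A y) f s).
  rewrite (_ : (fun _ => _) =
      (fun y => \int[mu]_(s in A y) g^\+ s - \int[mu]_(s in A y) g^\- s)).
    apply: measurable_funB; apply: key => //.
    - exact: integrable_funrpos.
    - exact: integrable_funrneg.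
  apply/funext => y; rewrite -RintegralB//; last 2 first.
    exact: integrable_funrpos.
    exact: integrable_funrneg.
  by apply: eq_Rintegral => x _; rewrite -[in LHS](funrposBneg g).
move=> f0 fi; apply: nondecreasing_measurable => // x y xy.
have iAf z : mu.-integrable (A z) (EFin \o f) by exact: integrableS fi.
rewrite /Rintegral fine_le ?integrable_fin_num//.
apply: ge0_subset_integral => //; last exact: Ahomo.
  by apply: measurable_int; exact: iAf.
by move=> z _; rewrite lee_fin.
Qed.

(** The number [l * fine (mu A)] is the integral of the constant [l], so the left side is the
    integral of [f - l], dominated by that of [e]. *)
Lemma Rintegral_mean_value d (T : measurableType d) (R : realType)
    (mu : {measure set T -> \bar R}) (A : set T) (f : T -> R) (l e : R) :
  measurable A -> (mu A < +oo)%E -> mu.-integrable A (EFin \o f) -> 0 <= e ->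
  {ae mu, forall y, A y -> `|f y - l| <= e} ->
  `|\int[mu]_(y in A) f y - l * fine (mu A)| <= e * fine (mu A).
Proof.
move=> mA Aoo fi e0 fle.
have ic (r : R) : mu.-integrable A (EFin \o cst r).
  apply: (@measurable_bounded_integrable _ _ _ mu (cst r)) => //.
  by exists `|r|; split => [|x xr y _ /=]; [exact: num_real|exact: ltW].
have ifl : mu.-integrable A (EFin \o (fun y => f y - l)).
  exact: (integrableB mA fi (ic l)).
rewrite -!Rintegral_cst// -RintegralB//; last exact: ic.
apply: le_trans (le_normr_Rintegral mA ifl) _.
have mfl : measurable_fun A (EFin \o (fun y => `|f y - l|)).
  by apply: measurable_int; exact: (integrable_norm ifl).
rewrite /Rintegral fine_le ?integrable_fin_num//.
- exact: (integrable_norm ifl).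
- exact: ic.
apply: ae_ge0_le_integral => //.
Qed.

(** Mean value estimate divided by the positive finite mass of [A h]. Closeness to [l] is asked only
    almost everywhere, to allow densities known up to null sets; the general filter covers left and
    right limits alike. *)
Lemma cvg_average d (T : measurableType d) (R : realType)
    (mu : {measure set T -> \bar R}) (I : Type) (F : set_system I)
    {FF : Filter F} (A : I -> set T) (f : T -> R) (l : R) :
  (\forall h \near F, [/\ measurable (A h), (0 < mu (A h) < +oo)%E &
    mu.-integrable (A h) (EFin \o f)]) ->
  (forall e, 0 < e ->
    \forall h \near F, {ae mu, forall y, A h y -> `|f y - l| <= e}) ->
  (\int[mu]_(y in A h) f y) / fine (mu (A h)) @[h --> F] --> l.
Proof.
move=> HA Hl; apply/cvgrPdist_le => e e0.
near=> h.
have [mA /andP[A0 Aoo] fi] : [/\ measurable (A h), (0 < mu (A h) < +oo)%E &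
    mu.-integrable (A h) (EFin \o f)] by near: h.
have m0 : 0 < fine (mu (A h)) by rewrite fine_gt0// A0.
have := @Rintegral_mean_value _ _ _ mu _ f l e mA Aoo fi (ltW e0).
move=> /(_ ltac:(near: h; exact: Hl)) H.
rewrite distrC -(ler_pM2r m0) -[X in _ * X <= _](gtr0_norm m0) -normrM.
by rewrite mulrBl divfK// gt_eqF.
Unshelve. all: by end_near. Qed.

(** * One-sided limits and periodicity *)

Lemma at_left_shift (R : realType) (U : Type) (f : R -> U) (x : R) :
  f y @[y --> x^'-] = f (x + h) @[h --> 0^'-].
Proof.
apply/funext => P.
change ((\forall y \near x, y < x -> P (f y)) =
        (\forall h \near 0, h < 0 -> P (f (x + h)))).
rewrite (near_shift 0 x)/= subr0; congr (nbhs _ _).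
by apply/funext => h/=; rewrite addrC gtrDl.
Qed.

Lemma at_right_shift (R : realType) (U : Type) (f : R -> U) (x : R) :
  f y @[y --> x^'+] = f (x + h) @[h --> 0^'+].
Proof.
apply/funext => P.
change ((\forall y \near x, x < y -> P (f y)) =
        (\forall h \near 0, 0 < h -> P (f (x + h)))).
rewrite (near_shift 0 x)/= subr0; congr (nbhs _ _).
by apply/funext => h/=; rewrite addrC ltrDl.
Qed.

Lemma periodic_int (R : realType) (U : Type) (f : R -> U) :
  (forall x, f (x + 1) = f x) -> forall (x : R) (n : int), f (x + n%:~R) = f x.
Proof.
move=> fE.
have natE n x : f (x + n%:R) = f x.
  by elim: n => [|n IH]; rewrite ?addr0// -natr1 addrA fE.
by move=> x [n|n]; rewrite -?pmulrn// NegzE mulrNz -pmulrn -(natE n.+1) subrK.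
Qed.

(** Periodicity of [P] is an equality in [Prop], so [periodic_int] applies to [P] as a function;
    subtracting the floor then lands in [0, 1). *)
Lemma periodic_ind_co (R : realType) (P : R -> Prop) :
  (forall x, P (x + 1) = P x) -> (forall x, 0 <= x < 1 -> P x) -> forall x, P x.
Proof.
move=> P1 P01 x; rewrite -(periodic_int P1 x (- Num.floor x)) rmorphN/=.
by apply: P01; have /andP[] := floor_itv x; rewrite intrD subr_ge0 ltrBlDl => -> ->.
Qed.

(** Variant for left-sided limits: the points just to the left of [x] lie in [0, 1] when [x] is in
    (0, 1], but not when [x] is 0. *)
Lemma periodic_ind_oc (R : realType) (P : R -> Prop) :
  (forall x, P (x + 1) = P x) -> (forall x, 0 < x <= 1 -> P x) -> forall x, P x.
Proof.
move=> P1 P01; apply: periodic_ind_co => // x /andP[].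
rewrite le_eqVlt => /predU1P[<- _|x0 x1].
  by rewrite -P1 add0r; apply: P01; rewrite ltr01 lexx.
by apply: P01; rewrite x0 ltW.
Qed.

Lemma cvg_dominated (R : realType) (I : Type) (F : set_system I) {FF : Filter F}
    (u w : I -> R) (l w0 M : R) :
  (\forall h \near F, `|u h - l| <= M * `|w h - w0|) ->
  w h @[h --> F] --> w0 -> u h @[h --> F] --> l.
Proof.
move=> uw wc; apply/cvgrPdist_le => e e0.
(* No sign is assumed on [M]; this replacement is a positive divisor. *)
have M0 : 0 < `|M| + 1 by rewrite ltr_wpDl.
have /cvgrPdist_le/(_ _ (divr_gt0 e0 M0)) we := wc.
near=> h.
rewrite distrC (@le_trans _ _ (M * `|w h - w0|))//; first by near: h.
rewrite (@le_trans _ _ ((`|M| + 1) * `|w h - w0|))//.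
  by rewrite ler_wpM2r// (le_trans (ler_norm _))// lerDl.
by rewrite -ler_pdivlMl// mulrC distrC; near: h.
Unshelve. all: by end_near. Qed.

(** A quotient sees only increments of [W], and these are periodic although [W] itself need not be.
    Equality as functions of [h] transfers limits too. *)
Lemma quotient_periodic (R : realType) (W f : R -> R) :
  (forall x, W (x + 1) - W x = W 1 - W 0) -> periodic f 1 ->
  forall x, quotient W f (x + 1) = quotient W f x.
Proof.
move=> WE fE x; apply/funext => h; rewrite /quotient (addrAC x) !fE.
congr (_ / _).
have WS y : W (y + 1) = W y + (W 1 - W 0) by rewrite -(WE y) addrCA subrr addr0.
by rewrite !WS opprD addrACA subrr addr0.
Qed.

(** Solve the quotient for [f (x + h)]. The limit obtained may differ from [f x] when [W] jumps;
    this provides the one-sided limits on the side where continuity can fail. *)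
Lemma cvg_of_quotient (R : realType) (W f : R -> R) (x : R) (F : set_system R)
    {FF : ProperFilter F} :
  (\forall h \near F, W (x + h) - W x != 0) ->
  cvg (quotient W f x h @[h --> F]) -> cvg (W (x + h) @[h --> F]) ->
  cvg (f (x + h) @[h --> F]).
Proof.
move=> W0 qc Wc.
have : (quotient W f x h * (W (x + h) - W x) + f x) @[h --> F] -->
    lim (quotient W f x h @[h --> F]) * (lim (W (x + h) @[h --> F]) - W x) + f x.
  apply: cvgD; last exact: cvg_cst.
  by apply: cvgM => //; apply: cvgB => //; exact: cvg_cst.
move=> H; apply/cvg_ex; eexists; apply: cvg_trans H.
apply: near_eq_cvg; near=> h.
by rewrite /quotient divfK ?subrK//; near: h.
Unshelve. all: by end_near. Qed.

(** * Periodic extension from the unit interval *)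

Definition periodize (R : realType) (f : R -> R) (x : R) : R :=
  f (x - (Num.floor x)%:~R).

Lemma periodize_periodic (R : realType) (f : R -> R) : periodic (periodize f) 1.
Proof.
move=> x; rewrite /periodize (_ : Num.floor (x + 1) = Num.floor x + 1).
  by rewrite intrD opprD addrACA subrr addr0.
have /andP[? ?] := floor_itv x.
by apply: floor_def; rewrite !intrD lerD2r ltrD2r -intrD; apply/andP.
Qed.

(** At [x = 1] the fractional part is 0, and [f 0 = f 1] saves the value there. *)
Lemma periodizeE (R : realType) (f : R -> R) (x : R) :
  f 0 = f 1 -> 0 <= x <= 1 -> periodize f x = f x.
Proof.
move=> f01 /andP[x0]; rewrite le_eqVlt => /predU1P[->|x1].
  by rewrite /periodize floor1 subrr.
by rewrite /periodize (@floor_def _ _ 0) ?subr0// x0.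
Qed.

Lemma measurable_periodize (R : realType) (f : R -> R) :
  measurable_fun setT f -> measurable_fun setT (periodize f).
Proof.
move=> mf; apply: (measurableT_comp mf).
apply: measurable_funB => //; apply: nondecreasing_measurable => // x y xy.
by rewrite ler_int; exact: le_floor.
Qed.

(** * One-sided differentiation of primitives *)

Lemma near_left_itv (R : realType) (x : R) (P : R -> Prop) :
  (\forall h \near 0^'-, P (x + h)) ->
  \forall h \near 0^'-, forall y, x + h < y < x -> P y.
Proof.
move=> [e/= e0 eP]; exists e => //= h; rewrite /= sub0r normrN => he h0 y /andP[hy yx].
rewrite -(subrK x y) addrC; apply: eP; last by rewrite subr_lt0.
rewrite /= sub0r normrN ltr0_norm ?subr_lt0// opprB.
by rewrite (le_lt_trans _ he)// ltr0_norm// lerBlDl -lerBlDr opprK ltW.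
Qed.

Lemma near_right_itv (R : realType) (x : R) (P : R -> Prop) :
  (\forall h \near 0^'+, P (x + h)) ->
  \forall h \near 0^'+, forall y, x < y < x + h -> P y.
Proof.
move=> [e/= e0 eP]; exists e => //= h; rewrite /= sub0r normrN => he h0 y /andP[xy yh].
rewrite -(subrK x y) addrC; apply: eP; last by rewrite subr_gt0.
rewrite /= sub0r normrN gtr0_norm ?subr_gt0//.
by rewrite (le_lt_trans _ he)// gtr0_norm// lerBlDl ltW.
Qed.

(** For [h < 0] the quotient is the [dW]-average of [G] over []x + h, x]]. An atom at [x] does no
    harm, since [G x] is itself the left limit; hence the derivative is found at the given point and
    not just almost everywhere. *)
Lemma left_quotient_primitive (R : realType) (W phi G : R -> R)
    (dW : {measure set (measurableTypeR R) -> \bar R}) (x : R) :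
  {homo W : x y / x < y} ->
  (forall a b : R, a <= b -> dW `]a, b]%classic = (W b - W a)%:E) ->
  dW.-integrable `]0, 1] (EFin \o G) ->
  (forall a b, 0 <= a -> a <= b -> b <= 1 ->
    phi b - phi a = \int[dW]_(t in `]a, b]) G t) ->
  0 < x <= 1 -> G (x + h) @[h --> 0^'-] --> G x ->
  quotient W phi x h @[h --> 0^'-] --> G x.
Proof.
move=> W_incr dWE iG phiE /andP[x0 x1] Gx.
have near0 : \forall h \near (0 : R)^'-, - x <= h < 0.
  near=> h; apply/andP; split; near: h; last exact: nbhs_left_lt.
  by apply: nbhs_left_ge; rewrite oppr_lt0.
have avg : (\int[dW]_(t in `]x + h, x]) G t) / fine (dW `]x + h, x]%classic)
    @[h --> 0^'-] --> G x.
  apply: cvg_average => [|e e0].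
    near=> h.
    have /andP[xh h0] : - x <= h < 0 by near: h.
    have hx : x + h < x by rewrite gtrDl.
    split => //.
      by rewrite dWE ?(ltW hx)// lte_fin subr_gt0 W_incr//= ltry.
    apply: integrableS iG => // t/=; rewrite !in_itv/= => /andP[t1 t2].
    by rewrite (le_lt_trans _ t1) ?(le_trans t2)// -lerBlDl sub0r.
  have /cvgrPdist_le/(_ _ e0)/(@near_left_itv _ _ (fun y => `|G x - G y| <= e))
    := Gx.
  apply: filterS => h H; apply: aeW => t/=; rewrite in_itv/= => /andP[ht].
  (* The left neighbourhood omits [t = x], where the difference vanishes anyway. *)
  rewrite le_eqVlt => /predU1P[->|tx]; first by rewrite subrr normr0 ltW.
  by rewrite distrC H// ht.
apply: cvg_trans avg; apply: near_eq_cvg; near=> h.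
have /andP[xh h0] : - x <= h < 0 by near: h.
have hx : x + h < x by rewrite gtrDl.
rewrite /quotient dWE ?(ltW hx)//= -phiE ?(ltW hx)//; last first.
  by rewrite -lerBlDl sub0r.
(* For [h < 0] numerator and denominator are both opposite to the increments over []x + h, x]]; the
   signs cancel. *)
by rewrite -(opprB (phi _)) -(opprB (W _)) invrN mulrNN.
Unshelve. all: by end_near. Qed.

(** Mirror image, with averages over [[x, x + h[]. Averages cannot tell [g] from its representative
    [k], whose right continuity at [x] gives the limit. *)
Lemma right_quotient_primitive (R : realType) (V G g k : R -> R)
    (dV : {measure set (measurableTypeR R) -> \bar R}) (x : R) :
  {homo V : x y / x < y} ->
  (forall a b : R, a <= b -> dV `[a, b[%classic = (V b - V a)%:E) ->
  dV.-integrable `[0, 1[ (EFin \o g) ->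
  (forall a b, 0 <= a -> a <= b -> b <= 1 ->
    G b - G a = \int[dV]_(t in `[a, b[) g t) ->
  {ae dV, forall y, 0 <= y < 1 -> g y = k y} ->
  0 <= x < 1 -> k (x + h) @[h --> 0^'+] --> k x ->
  quotient V G x h @[h --> 0^'+] --> k x.
Proof.
move=> V_incr dVE ig GE gk /andP[x0 x1] kx.
have near0 : \forall h \near (0 : R)^'+, 0 < h <= 1 - x.
  near=> h; apply/andP; split; near: h; first exact: nbhs_right_gt.
  by apply: nbhs_right_le; rewrite subr_gt0.
have avg : (\int[dV]_(t in `[x, x + h[) g t) / fine (dV `[x, x + h[%classic)
    @[h --> 0^'+] --> k x.
  apply: cvg_average => [|e e0].
    near=> h.
    have /andP[h0 xh] : 0 < h <= 1 - x by near: h.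
    have hx : x < x + h by rewrite ltrDl.
    split => //.
      by rewrite dVE ?(ltW hx)// lte_fin subr_gt0 V_incr//= ltry.
    apply: integrableS ig => // t/=; rewrite !in_itv/= => /andP[t1 t2].
    by rewrite (le_trans x0 t1) (lt_le_trans t2)// -lerBrDl.
  have /cvgrPdist_le/(_ _ e0)/(@near_right_itv _ _ (fun y => `|k x - k y| <= e)) H0
    := kx.
  near=> h.
  have /andP[h0 xh] : 0 < h <= 1 - x by near: h.
  have H : forall y, x < y < x + h -> `|k x - k y| <= e by near: h.
  apply: (filterS (Filter := ae_filter_ringOfSetsType dV) _ gk) => t gkt/=.
  rewrite in_itv/= => /andP[xt th].
  rewrite gkt; last by rewrite (le_trans x0 xt) (lt_le_trans th)// -lerBrDl.
  move: xt; rewrite le_eqVlt => /predU1P[<-|xt]; first by rewrite subrr normr0 ltW.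
  by rewrite distrC H// xt.
apply: cvg_trans avg; apply: near_eq_cvg; near=> h.
have /andP[h0 xh] : 0 < h <= 1 - x by near: h.
have hx : x < x + h by rewrite ltrDl.
by rewrite /quotient dVE ?(ltW hx)//= -GE ?(ltW hx)// -lerBrDl.
Unshelve. all: by end_near. Qed.

Lemma le_normr_Rintegral_fine d (T : measurableType d) (R : realType)
    (mu : {measure set T -> \bar R}) (A : set T) (f : T -> R) (M : R) :
  measurable A -> (mu A < +oo)%E -> mu.-integrable A (EFin \o f) -> 0 <= M ->
  {ae mu, forall y, A y -> `|f y| <= M} ->
  `|\int[mu]_(y in A) f y| <= M * fine (mu A).
Proof.
move=> mA Aoo fi M0 fM.
rewrite -[X in `|X|]subr0 -(mul0r (fine (mu A))).
apply: Rintegral_mean_value => //.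
by apply: (filterS (Filter := ae_filter_ringOfSetsType mu) _ fM) => y; rewrite subr0.
Qed.

Lemma le_normr_Rintegral_subset d (T : measurableType d) (R : realType)
    (mu : {measure set T -> \bar R}) (A D : set T) (f : T -> R) :
  measurable A -> measurable D -> A `<=` D -> mu.-integrable D (EFin \o f) ->
  `|\int[mu]_(y in A) f y| <= \int[mu]_(y in D) `|f y|.
Proof.
move=> mA mD AD fi.
have nfi : mu.-integrable D (EFin \o (fun x => `|f x|)) by exact: (integrable_norm fi).
apply: le_trans (le_normr_Rintegral mA (integrableS mD mA AD fi)) _.
rewrite /Rintegral fine_le ?integrable_fin_num//.
  exact: integrableS nfi.
apply: ge0_subset_integral => //.
by apply: measurable_int; exact: nfi.
Qed.

(** * Regularity of periodic solutions of the first order system *)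

Section first_order_system.
Context (R : realType) (W V phi G g : R -> R) (c : R).
Context (dW dV : {measure set (measurableTypeR R) -> \bar R}).
Hypotheses (W_incr : {homo W : x y / x < y}) (V_incr : {homo V : x y / x < y}).
Hypotheses (W_cadlag : cadlag W) (V_caglad : caglad V).
Hypotheses (W_per : forall x, W (x + 1) - W x = W 1 - W 0)
  (V_per : forall x, V (x + 1) - V x = V 1 - V 0).
Hypotheses (dWE : forall a b : R, a <= b -> dW `]a, b]%classic = (W b - W a)%:E)
  (dVE : forall a b : R, a <= b -> dV `[a, b[%classic = (V b - V a)%:E).
Hypotheses (phi_per : periodic phi 1) (G_per : periodic G 1).
Hypotheses (G_int : dW.-integrable `]0, 1] (EFin \o G))
  (g_int : dV.-integrable `[0, 1[ (EFin \o g)).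
Hypotheses
  (phiE : forall a b, 0 <= a -> a <= b -> b <= 1 ->
    phi b - phi a = \int[dW]_(t in `]a, b]) G t)
  (GE : forall a b, 0 <= a -> a <= b -> b <= 1 ->
    G b - G a = \int[dV]_(t in `[a, b[) g t).
Hypothesis gE : {ae dV, forall y, 0 <= y < 1 -> g y = c * phi y}.

(** Start of the bootstrap: the increment of [G] from 0 is at most the total integral of [|g|], so
    integrability of [g] suffices. *)
Lemma G_bounded : exists2 M, 0 <= M & forall x, 0 <= x <= 1 -> `|G x| <= M.
Proof.
exists (`|G 0| + \int[dV]_(t in `[0, 1[) `|g t|).
  by rewrite addr_ge0// Rintegral_ge0.
move=> x /andP[x0 x1]; rewrite -[G x](subrK (G 0)) addrC.
rewrite (le_trans (ler_normD _ _))// lerD2l GE//.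
apply: le_normr_Rintegral_subset => //.
by move=> t/=; rewrite !in_itv/= => /andP[-> tx]; exact: lt_le_trans x1.
Qed.

Lemma phi_lipschitz : exists2 M, 0 <= M &
  forall a b, 0 <= a -> a <= b -> b <= 1 -> `|phi b - phi a| <= M * (W b - W a).
Proof.
have [M M0 GM] := G_bounded; exists M => // a b a0 ab b1.
have sub : `]a, b] `<=` `]0, 1].
  move=> t/=; rewrite !in_itv/= => /andP[ta tb].
  by rewrite (le_lt_trans a0 ta) (le_trans tb).
rewrite phiE// -[W b - W a]/(fine (W b - W a)%:E) -dWE//.
apply: le_normr_Rintegral_fine => //.
- by rewrite dWE// ltry.
- exact: integrableS G_int.
- by apply: aeW => t /sub/=; rewrite in_itv/= => /andP[/ltW t0 t1]; rewrite GM// t0.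
Qed.

Lemma phi_bounded : exists2 M, 0 <= M & forall x, 0 <= x <= 1 -> `|phi x| <= M.
Proof.
have W_le : {homo W : x y / x <= y} by exact: ltW_homo.
have [M M0 phiM] := phi_lipschitz.
exists (`|phi 0| + M * (W 1 - W 0)).
  by rewrite addr_ge0// mulr_ge0// subr_ge0 W_le.
move=> x /andP[x0 x1]; rewrite -[phi x](subrK (phi 0)) addrC.
rewrite (le_trans (ler_normD _ _))// lerD2l (le_trans (phiM _ _ _ _ _))//.
by rewrite ler_wpM2l// lerD2r W_le.
Qed.

(** Second round of the bootstrap: [g] was only integrable, but it agrees almost everywhere with
    [c * phi], which is now known to be bounded. *)
Lemma G_lipschitz : exists2 M, 0 <= M &
  forall a b, 0 <= a -> a <= b -> b <= 1 -> `|G b - G a| <= M * (V b - V a).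
Proof.
have [M M0 phiM] := phi_bounded.
exists (`|c| * M); first by rewrite mulr_ge0.
move=> a b a0 ab b1.
have sub : `[a, b[ `<=` `[0, 1[.
  move=> t/=; rewrite !in_itv/= => /andP[ta tb].
  by rewrite (le_trans a0 ta) (lt_le_trans tb).
rewrite GE// -[V b - V a]/(fine (V b - V a)%:E) -dVE//.
apply: le_normr_Rintegral_fine => //.
- by rewrite dVE// ltry.
- exact: integrableS g_int.
- by rewrite mulr_ge0.
apply: (filterS (Filter := ae_filter_ringOfSetsType dV) _ gE) => t gt /sub/=.
rewrite in_itv/= => /[dup] t01 /gt ->; rewrite normrM ler_wpM2l// phiM//.
by case/andP: t01 => -> /ltW.
Qed.

Lemma phi_right_continuous x : phi (x + h) @[h --> 0^'+] --> phi x.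
Proof.
(* For [x] in [0, 1) and small [h > 0], the point [x + h] stays in [0, 1], where the estimate on
   [phi] is available. *)
move: x; apply: periodic_ind_co => [x|x /andP[x0 x1]].
  by under eq_fun do rewrite addrAC phi_per; rewrite phi_per.
have [M M0 phiM] := phi_lipschitz.
have := (W_cadlag x).1; rewrite at_right_shift.
apply: (@cvg_dominated _ _ _ _ _ _ _ _ M).
have x10 : 0 < 1 - x by rewrite subr_gt0.
near=> h.
have h0 : 0 < h by near: h; exact: nbhs_right_gt.
have hx : h <= 1 - x by near: h; exact: nbhs_right_le.
have xh : x < x + h by rewrite ltrDl.
rewrite (gtr0_norm (_ : 0 < W (x + h) - _)) ?subr_gt0 ?W_incr//.
by rewrite phiM// ?(ltW xh)// -lerBrDl.
Unshelve. all: by end_near. Qed.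

Lemma G_left_continuous x : G (x + h) @[h --> 0^'-] --> G x.
Proof.
move: x; apply: periodic_ind_oc => [x|x /andP[x0 x1]].
  by under eq_fun do rewrite addrAC G_per; rewrite G_per.
have [M M0 GM] := G_lipschitz.
have := (V_caglad x).1; rewrite at_left_shift.
apply: (@cvg_dominated _ _ _ _ _ _ _ _ M).
have x10 : - x < 0 by rewrite oppr_lt0.
near=> h.
have h0 : h < 0 by near: h; exact: nbhs_left_lt.
have hx : - x <= h by near: h; exact: nbhs_left_ge.
have xh : x + h < x by rewrite gtrDl.
rewrite !(distrC _ (_ x)) (gtr0_norm (_ : 0 < V x - _)) ?subr_gt0 ?V_incr//.
by rewrite GM// ?(ltW xh)// -lerBlDl sub0r.
Unshelve. all: by end_near. Qed.

Lemma left_quotient_phi x : quotient W phi x h @[h --> 0^'-] --> G x.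
Proof.
move: x; apply: periodic_ind_oc => [x|x x01].
  by rewrite G_per quotient_periodic.
apply: (@left_quotient_primitive _ _ _ _ dW) => //.
exact: G_left_continuous.
Qed.

Lemma right_quotient_G x : quotient V G x h @[h --> 0^'+] --> c * phi x.
Proof.
move: x; apply: periodic_ind_co => [x|x x01].
  by rewrite phi_per quotient_periodic.
apply: (@right_quotient_primitive _ _ _ g (fun x => c * phi x) dV) => //.
by apply: (cvgM (f := cst c)); [exact: cvg_cst|exact: phi_right_continuous].
Qed.

(** Left limits come from the existence of the left derivative together with the left limits of
    [W]. *)
Lemma phi_cadlag : cadlag phi.
Proof.
move=> x; rewrite at_right_shift at_left_shift; split.
  exact: phi_right_continuous.
apply: (@cvg_of_quotient _ W).
- near=> h; rewrite lt_eqF// subr_lt0 W_incr// gtrDl.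
  by near: h; exact: nbhs_left_lt.
- by apply: cvgP; exact: left_quotient_phi.
- by rewrite -at_left_shift; exact: (W_cadlag x).2.
Unshelve. all: by end_near. Qed.

Lemma G_caglad : caglad G.
Proof.
move=> x; rewrite at_right_shift at_left_shift; split.
  exact: G_left_continuous.
apply: (@cvg_of_quotient _ V).
- near=> h; rewrite gt_eqF// subr_gt0 V_incr// ltrDl.
  by near: h; exact: nbhs_right_gt.
- by apply: cvgP; exact: right_quotient_G.
- by rewrite -at_right_shift; exact: (V_caglad x).2.
Unshelve. all: by end_near. Qed.

End first_order_system.

(** * Restriction of a measure to the fundamental domain *)

Lemma ae_mrestr d (T : measurableType d) (R : realType)
    (mu : {measure set T -> \bar R}) (D : set T) (mD : measurable D) (P : T -> Prop) :
  {ae mrestr mu mD, forall x, P x} <-> {ae mu, forall x, D x -> P x}.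
Proof.
split=> -[A [mA A0 PA]].
  exists (A `&` D); split => //; first exact: measurableI.
  by move=> x /= /not_implyP[Dx nPx]; split => //; exact: PA.
(* The complement of [D] is null for the restricted measure, so it can join the exceptional set. *)
exists (A `|` ~` D); split.
- by apply: measurableU => //; exact: measurableC.
- rewrite /= /mrestr setIUl setICl setU0.
  apply: (@subset_measure0 _ _ _ mu _ A) => //.
  exact: measurableI.
- move=> x /= nPx; have [Dx|] := pselect (D x); last by right.
  by left; apply: PA => /(_ Dx).
Qed.

Lemma integrable_mrestr d (T : measurableType d) (R : realType)
    (mu : {measure set T -> \bar R}) (D : set T) (mD : measurable D)
    (f : T -> \bar R) :
  (mrestr mu mD).-integrable setT f -> mu.-integrable D f.
Proof.
move=> /(integrableS measurableT mD (@subsetT _ D))/integrableP[mf foo].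
apply/integrableP; split=> //; apply: le_lt_trans foo.
rewrite le_eqVlt; apply/orP; left; apply/eqP; apply: eq_measure_integral => A mA AD.
by rewrite /= /mrestr setIidl.
Qed.

Lemma Rintegral_mrestr d (T : measurableType d) (R : realType)
    (mu : {measure set T -> \bar R}) (D : set T) (mD : measurable D) (f : T -> R) :
  (mrestr mu mD).-integrable setT (EFin \o f) ->
  \int[mrestr mu mD]_x f x = \int[mu]_(x in D) f x.
Proof.
move=> fi; congr fine.
rewrite (negligible_integral (measurableC mD))//; last first.
  by rewrite /= /mrestr setICl.
rewrite setTD setCK; apply: eq_measure_integral => A mA AD.
by rewrite /= /mrestr setIidl.
Qed.

Lemma integrable_bounded d (T : measurableType d) (R : realType)
    (mu : {measure set T -> \bar R}) (D : set T) (f : T -> R) (M : R) :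
  measurable D -> (mu D < +oo)%E -> measurable_fun D f ->
  (forall x, D x -> `|f x| <= M) -> mu.-integrable D (EFin \o f).
Proof.
move=> mD Doo mf fM; apply: measurable_bounded_integrable => //.
exists M; split => [|r Mr x Dx /=]; first exact: num_real.
by rewrite (le_trans (fM _ Dx))// ltW.
Qed.

(** * Iterated derivatives of a solution *)

Lemma left_derive_scale (R : realType) (W f g : R -> R) (r : R) :
  (forall x, quotient W f x h @[h --> 0^'-] --> g x) ->
  left_derivable W (fun x => r * f x) /\
  left_derive W (fun x => r * f x) = (fun x => r * g x).
Proof.
move=> fg.
have rfg x : quotient W (fun y => r * f y) x h @[h --> 0^'-] --> r * g x.
  rewrite [X in fmap X](_ : _ = cst r \* quotient W f x).
    by apply: cvgM; [exact: cvg_cst|exact: fg].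
  by apply/funext => h; rewrite /quotient/= -mulrBr mulrA.
split=> [x|]; first by apply: cvgP; exact: rfg.
by apply/funext => x; apply: cvg_lim (rfg x).
Qed.

Lemma right_derive_scale (R : realType) (V f g : R -> R) (r : R) :
  (forall x, quotient V f x h @[h --> 0^'+] --> g x) ->
  right_derivable V (fun x => r * f x) /\
  right_derive V (fun x => r * f x) = (fun x => r * g x).
Proof.
move=> fg.
have rfg x : quotient V (fun y => r * f y) x h @[h --> 0^'+] --> r * g x.
  rewrite [X in fmap X](_ : _ = cst r \* quotient V f x).
    by apply: cvgM; [exact: cvg_cst|exact: fg].
  by apply/funext => h; rewrite /quotient/= -mulrBr mulrA.
split=> [x|]; first by apply: cvgP; exact: rfg.
by apply/funext => x; apply: cvg_lim (rfg x).
Qed.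

Lemma zero_mean_scale (R : realType) (mu : {measure set (measurableTypeR R) -> \bar R})
    (f : R -> R) (r : R) :
  (torus mu).-integrable setT (EFin \o f) -> zero_mean mu f ->
  zero_mean mu (fun x => r * f x).
Proof. by move=> fi f0; rewrite /zero_mean RintegralZl// f0 mulr0. Qed.

(** The two derivatives exchange [phi] and [G], and each return to [phi] costs one factor [c]. *)
Lemma WV_derivable_system (R : realType) (W V phi G : R -> R) (c : R) (k : nat) :
  (forall x, quotient W phi x h @[h --> 0^'-] --> G x) ->
  (forall x, quotient V G x h @[h --> 0^'+] --> c * phi x) ->
  WV_derivable W V k phi /\
  WV_derive W V k phi = (fun x => c ^+ k./2 * (if odd k then G else phi) x).
Proof.
move=> phiG Gphi; elim: k => [|k [kd kE]].
  by split=> //; apply/funext => x; rewrite mul1r.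
(* Half of [k + 1] exceeds half of [k] exactly for odd [k], that is, when the right derivative with
   respect to [V] produces the factor [c]. *)
rewrite /= kE uphalf_half; case: (odd k) => /=.
- have [dG ->] := right_derive_scale (c ^+ k./2) Gphi.
  by split=> //; apply/funext => x; rewrite exprSr mulrA.
- by have [dphi ->] := left_derive_scale (c ^+ k./2) phiG.
Qed.

Lemma Coo_of_system (R : realType) (W V phi G : R -> R) (c : R)
    (dW dV : {measure set (measurableTypeR R) -> \bar R}) :
  (forall x, quotient W phi x h @[h --> 0^'-] --> G x) ->
  (forall x, quotient V G x h @[h --> 0^'+] --> c * phi x) ->
  (torus dV).-integrable setT (EFin \o phi) ->
  (torus dW).-integrable setT (EFin \o G) ->
  C0_torus dV phi -> C1_torus dW G -> Coo_WV0 W V dW dV phi.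
Proof.
move=> phiG Gphi phi_int G_int phiC GC n; split=> // k _.
have [kd kE] := WV_derivable_system k phiG Gphi; split=> //.
rewrite /Csigma_torus kE; case: (odd k).
- case: GC => Gper Gcont G0; split; last exact: zero_mean_scale.
    by move=> x; rewrite Gper.
  move=> x; have [Gl Gr] := Gcont x; split.
    by apply: (cvgM (f := cst _)); [exact: cvg_cst|].
  by apply: cvgP; apply: (cvgM (f := cst _)); [exact: cvg_cst|exact: Gr].
- case: phiC => phiper phicont phi0; split; last exact: zero_mean_scale.
    by move=> x; rewrite phiper.
  move=> x; have [phir phil] := phicont x; split.
    by apply: (cvgM (f := cst _)); [exact: cvg_cst|].
  by apply: cvgP; apply: (cvgM (f := cst _)); [exact: cvg_cst|exact: phil].
Qed.

(** * Interval integrals and atoms *)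

Lemma Rintegral_itvD (R : realType) (mu : {measure set (measurableTypeR R) -> \bar R})
    (a b c : itv_bound R) (f : R -> R) :
  (a <= b)%O -> (b <= c)%O -> mu.-integrable [set` Interval a c] (EFin \o f) ->
  \int[mu]_(t in [set` Interval a c]) f t - \int[mu]_(t in [set` Interval a b]) f t =
  \int[mu]_(t in [set` Interval b c]) f t.
Proof.
move=> ab bc fi; have acE := itv_bndbnd_setU ab bc.
rewrite acE (Rintegral_setU (mu := mu)) -?acE//.
  by rewrite addrAC subrr add0r.
apply/disj_setPS => t [/=]; rewrite !itv_boundlr => /andP[_ tb] /andP[bt _].
by have := le_trans tb bt; rewrite bnd_simp ltxx.
Qed.

(** The point lies in []x + h, x]], whose mass [W x - W (x + h)] tends to 0. *)
Lemma measure_set1_eq0 (R : realType) (W : R -> R)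
    (dW : {measure set (measurableTypeR R) -> \bar R}) (x : R) :
  (forall a b : R, a <= b -> dW `]a, b]%classic = (W b - W a)%:E) ->
  W (x + h) @[h --> 0^'-] --> W x -> dW [set x] = 0%E.
Proof.
move=> dWE Wx; apply/eqP; rewrite -measure_le0; apply/lee_addgt0Pr => e e0.
rewrite add0e; near (0 : R)^'- => h.
have h0 : h < 0 by near: h; exact: nbhs_left_lt.
have xh : x + h < x by rewrite gtrDl.
apply: (@le_trans _ _ (dW `]x + h, x]%classic)).
  by apply: le_measure; rewrite ?inE// => t/= ->; rewrite in_itv/= xh lexx.
rewrite dWE ?(ltW xh)// lee_fin (le_trans (ler_norm _))//.
by near: h; move/cvgrPdist_le : Wx; exact.
Unshelve. all: by end_near. Qed.

(** Each side is the integral over [[a, b]] less a null endpoint. It reconciles the torus domain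
    [[0, 1[] with the interval []0, 1]] natural for [dW]. *)
Lemma Rintegral_itvco_itvoc (R : realType)
    (mu : {measure set (measurableTypeR R) -> \bar R}) (a b : R) (f : R -> R) :
  mu [set a] = 0%E -> mu [set b] = 0%E -> mu.-integrable `[a, b] (EFin \o f) ->
  \int[mu]_(t in `[a, b[) f t = \int[mu]_(t in `]a, b]) f t.
Proof.
move=> a0 b0 fi; congr fine.
rewrite -[in LHS](setDitv1r _ _ false) -[in RHS](setDitv1l _ _ true).
by rewrite -(negligible_integral _ _ fi b0)// -(negligible_integral _ _ fi a0).
Qed.

Lemma periodic_extension (R : realType) (f : R -> R) :
  measurable_fun setT f -> f 0 = f 1 ->
  exists g : R -> R, [/\ periodic g 1, measurable_fun setT g &
    forall x, 0 <= x <= 1 -> g x = f x].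
Proof.
move=> mf f01; exists (periodize f); split.
- exact: periodize_periodic.
- exact: measurable_periodize.
- by move=> x; exact: periodizeE.
Qed.

Theorem theorem1p3p1 (R : realType) (W V : R -> R)
  (W_incr : {homo W : x y / x < y}) (V_incr : {homo V : x y / x < y})
  (W_cadlag : cadlag W) (V_caglad : caglad V)
  (W_per : forall x, W (x + 1) - W x = W 1 - W 0)
  (V_per : forall x, V (x + 1) - V x = V 1 - V 0)
  (W_cont0 : {for 0, continuous W}) (V_cont0 : {for 0, continuous V})
  (W0 : W 0 = 0) (V0 : V 0 = 0)
  (dW dV : {measure set (measurableTypeR R) -> \bar R})
  (dWE : forall a b : R, a <= b -> dW `]a, b]%classic = (W b - W a)%:E)
  (dVE : forall a b : R, a <= b -> dV `[a, b[%classic = (V b - V a)%:E)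
  (lambda : R) (lambda_neq0 : lambda <> 0) (psi : R -> R)
  (psi_eigen : exists Dpsi : R -> R, WV_laplacian W dW dV psi Dpsi /\
    {ae torus dV, forall x, - Dpsi x = lambda * psi x}) :
  exists phi : R -> R, Coo_WV0 W V dW dV phi /\
    {ae torus dV, forall x, psi x = phi x}.
Proof.

(* From the eigenfunction to a periodic solution *)
case: psi_eigen => g [[psiL2 [[[g_per gL2] g_mean] [a [b [psiE bE]]]]] eig].
have dW01 : (dW `]0%R, 1%R]%classic < +oo)%E by rewrite dWE// ltry.
have dV01 : (dV `[0%R, 1%R[%classic < +oo)%E by rewrite dVE// ltry.
(* [dWE] measures only intervals open on the left, so [[0, 1]] is enclosed in []-1, 1]]. *)
have dW01c : (dW `[0%R, 1%R]%classic < +oo)%E.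
  apply: (@le_lt_trans _ _ (dW `](-1)%R, 1%R]%classic)); last first.
    by rewrite dWE ?ltry// (@le_trans _ _ 0).
  apply: le_measure; rewrite ?inE// => t/=; rewrite !in_itv/= => /andP[t0 ->].
  by rewrite (lt_le_trans _ t0).
have torusW : (torus dW setT < +oo)%E.
  rewrite /torus/= /mrestr setTI; apply: le_lt_trans dW01c.
  by apply: le_measure; rewrite ?inE//; apply: subset_itvl; rewrite bnd_simp.
have torusV : (torus dV setT < +oo)%E by rewrite /torus/= /mrestr setTI.
have tg_int : (torus dV).-integrable setT (EFin \o g).
  apply/(Lfun1_integrable (mrestr dV _)).
  by apply: (@Lfun_subset12 _ _ _ (mrestr dV _)) gL2; rewrite ge0_fin_numE.
have g_int : dV.-integrable `[0, 1[ (EFin \o g) by exact: integrable_mrestr tg_int.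
(* Cutting at 1 makes the inner integral of the potential bounded and measurable on the whole line,
   without changing it for [y <= 1]. *)
pose F0 y := \int[dV]_(s in `[0, 1[ `&` `[0, y[) g s.
have mF0 : measurable_fun setT F0.
  apply: measurable_Rintegral_increasing g_int => //.
  - by move=> y; exact: measurableI.
  - move=> x y xy; apply: setIS => t/=; rewrite !in_itv/= => /andP[-> tx].
    exact: lt_le_trans xy.
(* Candidate for the left derivative of [psi]: the term [b * W x] contributes the constant density
   [b]. *)
pose G0 y := b + F0 y.
have mG0 : measurable_fun setT G0 by apply: measurable_funD.
have F0E y : y <= 1 -> F0 y = \int[dV]_(s in `[0, y[) g s.
  move=> y1; rewrite /F0 setIidr// => t/=; rewrite !in_itv/= => /andP[-> ty].
  exact: lt_le_trans y1.
have F0M y : `|F0 y| <= \int[dV]_(s in `[0, 1[) `|g s|.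
  apply: le_normr_Rintegral_subset => //; exact: measurableI.
have F0_int : dW.-integrable `]0, 1] (EFin \o F0).
  apply: (@integrable_bounded _ _ _ dW _ _ _ _ dW01) => //.
  exact: measurable_funTS.
have G0_int : dW.-integrable `]0, 1] (EFin \o G0).
  apply: (@integrable_bounded _ _ _ dW _ _
    (`|b| + \int[dV]_(s in `[0, 1[) `|g s|) _ dW01) => //.
    exact: measurable_funTS.
  by move=> x _; rewrite (le_trans (ler_normD _ _))// lerD2l.
have G0D x y : 0 <= x -> x <= y -> y <= 1 ->
    G0 y - G0 x = \int[dV]_(t in `[x, y[) g t.
  move=> x0 xy y1; rewrite /G0 opprD addrACA subrr add0r !F0E ?(le_trans xy)//.
  rewrite Rintegral_itvD ?bnd_simp//; apply: integrableS g_int => //.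
  by apply: subset_itvl; rewrite bnd_simp.
pose phi0 x := a + \int[dW]_(y in `]0, 1] `&` `]0, x]) G0 y.
have mphi0 : measurable_fun setT phi0.
  apply: measurable_funD => //; apply: measurable_Rintegral_increasing G0_int => //.
  - by move=> y; exact: measurableI.
  - move=> x y xy; apply: setIS => t/=; rewrite !in_itv/= => /andP[-> tx].
    exact: le_trans xy.
have phi0E x : x <= 1 -> phi0 x = a + \int[dW]_(t in `]0, x]) G0 t.
  move=> x1; rewrite /phi0 setIidr// => t/=; rewrite !in_itv/= => /andP[-> tx].
  exact: le_trans x1.
have phi0D x y : 0 <= x -> x <= y -> y <= 1 ->
    phi0 y - phi0 x = \int[dW]_(t in `]x, y]) G0 t.
  move=> x0 xy y1; rewrite !phi0E ?(le_trans xy)// opprD addrACA subrr add0r.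
  rewrite Rintegral_itvD ?bnd_simp//; apply: integrableS G0_int => //.
  by apply: subset_itvl; rewrite bnd_simp.
have phi0_potential x : 0 <= x -> x <= 1 ->
    phi0 x = a + b * W x + WV_potential dW dV g x.
  move=> x0 x1; have sub : `]0, x] `<=` `]0, 1].
    by apply: subset_itvl; rewrite bnd_simp.
  rewrite phi0E// /G0 RintegralD//; last 2 first.
  - apply: (@integrableS _ _ _ dW `]0, 1]) => //.
    exact: (@integrable_bounded _ _ _ dW _ _ `|b| _ dW01).
  - exact: integrableS F0_int.
  rewrite Rintegral_cst// dWE//= W0 subr0 addrA; congr (_ + _).
  apply: eq_Rintegral => y; rewrite inE/= in_itv/= => /andP[_ yx].
  by rewrite F0E// (le_trans yx).
(* The value at 0 is [a], and [bE] says that the rest of the formula vanishes at 1. *)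
have phi01 : phi0 0 = phi0 1.
  by rewrite [RHS]phi0_potential// phi0E// set_itvoc0 Rintegral_set0 -addrA bE.
(* The increment over the period is the integral of [g], which has zero mean. *)
have G01 : G0 0 = G0 1.
  apply/esym/eqP; rewrite -subr_eq0 G0D//; apply/eqP.
  by rewrite -[RHS]g_mean; apply/esym; exact: Rintegral_mrestr.
have [phi [phi_per mphi phi0phi]] := periodic_extension mphi0 phi01.
have [G [G_per mG G0G]] := periodic_extension mG0 G01.
clearbody phi0 G0 F0.
have phiD x y : 0 <= x -> x <= y -> y <= 1 ->
    phi y - phi x = \int[dW]_(t in `]x, y]) G t.
  move=> x0 xy y1; rewrite !phi0phi ?x0 ?y1 ?(le_trans xy) ?(le_trans x0)//.
  rewrite phi0D//; apply: eq_Rintegral => t; rewrite inE/= in_itv/= => /andP[xt ty].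
  by rewrite G0G// (le_trans ty)// (le_trans x0)// ltW.
have GD x y : 0 <= x -> x <= y -> y <= 1 ->
    G y - G x = \int[dV]_(t in `[x, y[) g t.
  by move=> x0 xy y1; rewrite !G0G ?x0 ?y1 ?(le_trans xy) ?(le_trans x0)// G0D.
have G_int : dW.-integrable `]0, 1] (EFin \o G).
  apply: eq_integrable G0_int => // t; rewrite inE/= in_itv/= => /andP[t0 t1].
  by rewrite G0G// t1 ltW.
have psi_phi : {ae dV, forall x, `[0, 1[%classic x -> psi x = phi x}.
  have /ae_mrestr := psiE.
  apply: (filterS (Filter := ae_filter_ringOfSetsType dV)) => x psix x01.
  rewrite psix//; move: x01; rewrite /= in_itv/= => /andP[x0 /ltW x1].
  by rewrite phi0phi ?x0// phi0_potential.
(* The eigenvalue equation closes the system with [c = - lambda]. *)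
have gE : {ae dV, forall x, 0 <= x < 1 -> g x = - lambda * phi x}.
  have /ae_mrestr eig' := eig.
  have := filterI (Filter := ae_filter_ringOfSetsType dV) psi_phi eig'.
  apply: (filterS (Filter := ae_filter_ringOfSetsType dV)) => x [psix gx] x01.
  have x01' : `[0, 1[%classic x by rewrite /= in_itv.
  by rewrite -psix// mulNr -gx// opprK.
have phi_int : (torus dV).-integrable setT (EFin \o phi).
  have [M _ phiM] := phi_bounded W_incr dWE G_int g_int phiD GD.
  apply: (@integrable_bounded _ _ _ (mrestr dV _) _ _ M _ torusV) => // x _.
  move: x; apply: periodic_ind_co => [x|x /andP[x0 /ltW x1]]; first by rewrite phi_per.
  by rewrite phiM// x0.
have [M _ GM] := G_bounded g_int GD.
have {}GM x : `|G x| <= M.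
  move: x; apply: periodic_ind_co => [x|x /andP[x0 /ltW x1]]; first by rewrite G_per.
  by rewrite GM// x0.
have tG_int : (torus dW).-integrable setT (EFin \o G).
  exact: (@integrable_bounded _ _ _ (mrestr dW _) _ _ M _ torusW).
(* The integral of [g] is the vanishing increment of [G] over a period and also [- lambda] times
   that of [phi]; [lambda_neq0] then gives zero mean. *)
have phi_mean : zero_mean dV phi.
  have phi_int01 : dV.-integrable `[0, 1[ (EFin \o phi).
    exact: integrable_mrestr phi_int.
  have : \int[dV]_(t in `[0, 1[) g t = - lambda * \int[dV]_(t in `[0, 1[) phi t.
    rewrite -RintegralZl//; congr fine; apply: ae_eq_integral => //.
    - exact: measurable_int g_int.
    - by apply/measurable_EFinP; apply: measurable_funM => //; exact: measurable_funTS.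
    - apply: (filterS (Filter := ae_filter_ringOfSetsType dV) _ gE) => x gx.
      by rewrite /= in_itv/= => /gx ->.
  rewrite -GD// !G0G ?lexx ?ler01// G01 subrr => /esym/eqP.
  rewrite mulf_eq0 oppr_eq0 => /orP[/eqP//|/eqP int0].
  by rewrite /zero_mean [LHS](Rintegral_mrestr (mu := dV)).
(* Over []0, 1]] the integral of [G] is the increment of [phi], hence 0. Passing to [[0, 1[]
   requires that [dW] have no atom at 0 or 1. *)
have G_mean : zero_mean dW G.
  have W_left0 : W (0 + h) @[h --> 0^'-] --> W 0.
    by rewrite -at_left_shift; exact: cvg_at_left_filter.
  have dW0 : dW [set 0] = 0%E by exact: measure_set1_eq0 dWE _.
  (* Continuity of [W] at 0 is carried to 1 by the periodicity of its increments. *)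
  have dW1 : dW [set 1] = 0%E.
    apply: measure_set1_eq0 dWE _.
    have WS h : W (1 + h) = W (0 + h) + (W 1 - W 0).
      by rewrite -(W_per h) add0r addrCA subrr addr0 addrC.
    rewrite (_ : W 1 = W 0 + (W 1 - W 0)); last by rewrite addrCA subrr addr0.
    under eq_fun do rewrite WS.
    by apply: cvgD => //; exact: cvg_cst.
  rewrite /zero_mean [LHS](Rintegral_mrestr (mu := dW))// Rintegral_itvco_itvoc//.
    by rewrite -phiD// !phi0phi ?lexx ?ler01// phi01 subrr.
  apply: (@integrable_bounded _ _ _ dW _ _ M _ dW01c) => //.
  exact: measurable_funTS.
exists phi; split; last by apply/ae_mrestr.
apply: (@Coo_of_system _ _ _ _ G (- lambda)) => //.
- exact: (@left_quotient_phi _ W V phi G g (- lambda) dW dV).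
- exact: (@right_quotient_G _ W V phi G g (- lambda) dW dV).
- by split => //; exact: (@phi_cadlag _ W V phi G g (- lambda) dW dV).
- by split => //; exact: (@G_caglad _ W V phi G g (- lambda) dW dV).
Qed.
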